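(* Let $\{w_k\}_{k\ge 0}$ be generated by Byzantine Resilient SGD, i.e. $w_{k+1}=w_k-\alpha_k A_k$ with $A_k=\mathrm{Agg}((\tilde g_1)_k,\dots,(\tilde g_m)_k)$, for the problem $\min_{w\in\mathbb{R}^d}F(w)=\frac1m\sum_{i=1}^m F_i(w)$, with the setting, notation and algorithm as described in the context. Suppose the following hold. 1. (Smoothness) Each term $F_i$ of the objective is $L$-smooth (continuously differentiable with $L$-Lipschitz gradient) and bounded below by $F_{\text{low}}\in\mathbb{R}$. 2. (Expected smoothness) For all $k$, $\mathbb{E}_k[G(w_k)]=\nabla F(w_k)$, and there are constants $A,B,C\ge 0$ independent of $k$ such that for all $k$ $$\mathbb{E}_k[\|G(w_k)\|^2]\le 2A(F(w_k)-F_{\text{low}})+B\|\nabla F(w_k)\|^2+C.$$ 3. ($\alpha$-Byzantine resilience) There is a constant angle $\alpha\in[0,\pi/2)$ such that for all $k$: (i) $\langle\mathbb{E}_k[A_k],\nabla F(w_k)\rangle\ge(1-\sin(\alpha))\|\nabla F(w_k)\|^2$; and (ii) for $r=2,3,4$, $\mathbb{E}_k[\|A_k\|^r]$ is bounded above by a linear combination (with coefficients independent of $k$) of terms $\mathbb{E}_k[\|G(w_k)\|^{r_1}]\cdots\mathbb{E}_k[\|G(w_k)\|^{r_n}]$ with $r_1+\dots+r_n=r$. Let $E$ be a constant such that $\mathbb{E}_k[\|A_k\|^2]\le E\,\mathbb{E}_k[\|G(w_k)\|^2]$ for all $k$ (such a constant exists by 3(ii) with $r=2$), and let $B'=BE$,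 with $LB'>0$. Suppose the learning rates $\alpha_k>0$ satisfy: $\{\alpha_k\}_{k\ge0}$ is non-increasing, $\alpha_0\le\frac{1-\sin(\alpha)}{LB'}$, $\sum_{k=0}^\infty\alpha_k^2<\infty$, and $\lim_{k\to\infty}\frac{1}{k\alpha_{k-1}}=0$. Then $$\lim_{K\to\infty}\left(\min_{0\le k\le K-1}\mathbb{E}[\|\nabla F(w_k)\|]\right)=0.$$
   Context: $\|\cdot\|$ and $\langle\cdot,\cdot\rangle$ are the Euclidean norm and inner product on $\mathbb{R}^d$. Problem. There are $m$ nodes; node $i$ holds a dataset $\{((x_i)_j,(y_i)_j)\}_{j=1}^{n_i}$ and $F_i(w)=\frac1{n_i}\sum_{j=1}^{n_i} l((y_i)_j,f((x_i)_j;w))$ is the empirical risk at node $i$ of a model $f(\cdot;w)$ with parameter $w\in\mathbb{R}^d$, $l$ being a loss function. The objective is $F=\frac1m\sum_{i=1}^m F_i$. Stochastic gradients. All random quantities live on a probability space. At iteration $k$, node $i$ draws a sample $(\zeta_k)_i$, and the correct gradient estimate of node $i$ is $(g_i)_k=g_i(w_k)=G(w_k,(\zeta_k)_i)$, where $G(w,\zeta)$ is a common random gradient model, not depending on the node. The data are i.i.d. across nodes, so the (conditional) law of $g_i(w_k)$ is the same for all $i$; $G(w_k)$ denotes a generic such estimate, so that $\mathbb{E}_k[G(w_k)]$ and $\mathbb{E}_k[\|G(w_k)\|^r]$ are the common values of $\mathbb{E}_k[g_i(w_k)]$ and $\mathbb{E}_k[\|g_i(w_k)\|^r]$. $\mathcal{F}_k$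 is the $\sigma$-algebra generated by all samples $(\zeta_i)_j$ with $0\le i\le k-1$, $1\le j\le m$, and $\mathbb{E}_k[\cdot]=\mathbb{E}[\cdot\mid\mathcal{F}_k]$. The iterate $w_k$ is $\mathcal{F}_k$-measurable. Byzantine adversaries. At each iteration $k$, $q$ of the $m$ nodes are Byzantine (the set may change with $k$). The server receives $(\tilde g_i)_k=(B_i)_k$ if node $i$ is Byzantine, and $(\tilde g_i)_k=(g_i)_k$ otherwise; $(B_i)_k\in\mathbb{R}^d$ is arbitrary and may depend on $(g_1)_k,\dots,(g_m)_k$, on the current iterate and step size, and on any previous information. Algorithm (Byzantine Resilient SGD). Input: initial point $w_0\in\mathbb{R}^d$, learning rates $\alpha_k>0$, and an aggregation function $\mathrm{Agg}:(\mathbb{R}^d)^m\to\mathbb{R}^d$. For $k=0,1,2,\dots$: compute $A_k=\mathrm{Agg}((\tilde g_1)_k,\dots,(\tilde g_m)_k)$ and set $w_{k+1}=w_k-\alpha_kA_k$. The angle $\alpha$ (no subscript) is unrelated to the learning rates $\alpha_k$. *)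

(* Defs.v *)
From HB Require Import structures.
From mathcomp Require Export all_boot all_order all_algebra.
From mathcomp Require Export all_classical all_reals all_analysis.
From mathcomp Require Export measurable_realfun.
Export numFieldNormedType.Exports.

Set Implicit Arguments.
Unset Strict Implicit.
Unset Printing Implicit Defensive.

Import Order.TTheory GRing.Theory Num.Theory.

Local Open Scope classical_set_scope.
Local Open Scope ring_scope.

(* R^d is 'rV[R]_d.  The library norm `|x| on matrices is the sup norm, hence
   the separate Euclidean norm below; both induce the same topology, so
   [open], [continuous] and [differentiable] are the library's. *)

Definition dotp (R : realType) (d : nat) (u v : 'rV[R]_d) : R :=
  \sum_(j < d) u 0 j * v 0 j.

Definition enorm (R : realType) (d : nat) (u : 'rV[R]_d) : R :=
  Num.sqrt (dotp u u).

Definition grad (R : realType) (d : nat) (f : 'rV[R]_d -> R) (w : 'rV[R]_d) :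
  'rV[R]_d := \row_(j < d) 'D_(delta_mx 0 j) f w.

Definition L_smooth (R : realType) (d : nat) (L : R) (f : 'rV[R]_d -> R) :
  Prop :=
  [/\ forall w, differentiable f w,
      continuous (grad f) &
      forall u v, enorm (grad f u - grad f v) <= L * enorm (u - v)].

Definition empirical_risk (R : realType) (d : nat) (X Y O : Type)
    (l : Y -> O -> R) (f : X -> 'rV[R]_d -> O)
    (n : nat) (x : 'I_n -> X) (y : 'I_n -> Y) (w : 'rV[R]_d) : R :=
  n%:R^-1 * \sum_(j < n) l (y j) (f (x j) w).

Definition borel (R : realType) (d : nat) : set (set 'rV[R]_d) := <<s open >>.
Arguments borel : clear implicits.

(* Measurability of X : (T, F) -> (U, S) for arbitrary set systems F and S,
   so that F may be a sub-sigma-algebra of the ambient one. *)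
Definition measurable_wrt (T U : Type) (F : set (set T)) (S : set (set U))
    (X : T -> U) : Prop :=
  preimage_set_system setT X S `<=` F.

(* Conditional expectations are only defined up to null sets: the predicates
   below say that Y is a version of E[X | F].  In the first one X and Y are
   nonnegative and may have infinite integral. *)
Definition is_condexp_nneg (dT : measure_display) (T : measurableType dT)
    (R : realType) (P : probability T R) (F : set (set T))
    (X Y : T -> \bar R) : Prop :=
  [/\ forall t, (0 <= Y t)%E,
      measurable_wrt F measurable Y &
      forall D, F D -> (\int[P]_(t in D) Y t = \int[P]_(t in D) X t)%E].

Definition is_condexp (dT : measure_display) (T : measurableType dT)
    (R : realType) (P : probability T R) (F : set (set T))
    (X Y : T -> R) : Prop :=
  [/\ P.-integrable setT (EFin \o X), P.-integrable setT (EFin \o Y),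
      measurable_wrt F measurable Y &
      forall D, F D ->
        (\int[P]_(t in D) (Y t)%:E = \int[P]_(t in D) (X t)%:E)%E].

Definition is_condexp_vec (dT : measure_display) (T : measurableType dT)
    (R : realType) (P : probability T R) (F : set (set T)) (d : nat)
    (X Y : T -> 'rV[R]_d) : Prop :=
  forall j : 'I_d, is_condexp P F (fun t => X t 0 j) (fun t => Y t 0 j).

Definition same_cond_law (dT : measure_display) (T : measurableType dT)
    (R : realType) (P : probability T R) (F : set (set T)) (d : nat)
    (X Y : T -> 'rV[R]_d) : Prop :=
  forall U, borel R d U -> forall p : T -> \bar R,
    is_condexp_nneg P F (fun t => (\1_(X @^-1` U) t)%:E) p <->
    is_condexp_nneg P F (fun t => (\1_(Y @^-1` U) t)%:E) p.

Definition past_samples (dT dZ : measure_display) (T : measurableType dT)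
    (Z : measurableType dZ) (m : nat) (zeta : nat -> 'I_m -> T -> Z)
    (k : nat) : set (set T) :=
  <<s \bigcup_(i in `I_k) \bigcup_(j in [set: 'I_m])
        preimage_set_system setT (zeta i j) measurable >>.

(* The linear combination \sum_p p.1 * \prod_(s in p.2) M s of products of
   moments, where M s stands for the moment of order s. *)
Definition moment_comb (R : realType) (c : seq (R * seq nat))
    (M : nat -> \bar R) : \bar R :=
  (\sum_(p <- c) (p.1)%:E * \prod_(s <- p.2) M s)%E.

(* Main.v *)
(* Write kappa = 1 - sin theta.  The quadratic upper bound of an L-smooth
   function, averaged over the nodes, conditioned on the past samples and
   combined with Byzantine resilience and expected smoothness, gives with
   D_k = E[F(w_k) - Flow] and a_k = E|grad F(w_k)|^2
     D_(k+1) + alpha_k kappa / 2 a_k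
       <= (1 + L E A alpha_k^2) D_k + L E C / 2 alpha_k^2;
   the step size bound absorbs the term L B' / 2 alpha_k^2 a_k into half of the
   descent.  As sum alpha_k^2 is finite, so is sum alpha_k a_k, and since alpha
   is nonincreasing min_(k < K) a_k = O(1 / (K alpha_(K-1))), which tends to 0.
   Finally 2 x <= r + x^2 / r passes from second to first moments. *)

Require Import Defs.
From mathcomp Require Import all_boot all_order all_algebra.
From mathcomp Require Import all_classical all_reals all_analysis.
From mathcomp Require Import measurable_realfun.
From mathcomp Require Import ring lra.

Set Implicit Arguments.
Unset Strict Implicit.
Unset Printing Implicit Defensive.

Import Order.TTheory GRing.Theory Num.Theory.
Import numFieldNormedType.Exports.

Local Open Scope classical_set_scope.
Local Open Scope ring_scope.

(** * Euclidean inner product and norm on row vectors *)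

Lemma dotp_suml (R : realType) (d : nat) (I : Type) (r : seq I)
    (u : I -> 'rV[R]_d) (v : 'rV[R]_d) :
  dotp (\sum_(i <- r) u i) v = \sum_(i <- r) dotp (u i) v.
Proof.
rewrite /dotp exchange_big; apply: eq_bigr => j _ /=.
by rewrite summxE mulr_suml.
Qed.

Lemma dotpZl (R : realType) (d : nat) (a : R) (u v : 'rV[R]_d) :
  dotp (a *: u) v = a * dotp u v.
Proof. by rewrite /dotp mulr_sumr; apply: eq_bigr => j _; rewrite !mxE mulrA. Qed.

Lemma dotpC (R : realType) (d : nat) (u v : 'rV[R]_d) : dotp u v = dotp v u.
Proof. by apply: eq_bigr => j _; rewrite mulrC. Qed.

Lemma dotpBl (R : realType) (d : nat) (u v w : 'rV[R]_d) :
  dotp (u - v) w = dotp u w - dotp v w.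
Proof. by rewrite /dotp -sumrB; apply: eq_bigr => j _; rewrite !mxE mulrBl. Qed.

Lemma dotp_ge0 (R : realType) (d : nat) (u : 'rV[R]_d) : 0 <= dotp u u.
Proof. by apply: sumr_ge0 => j _; rewrite -expr2 sqr_ge0. Qed.

Lemma enorm_sq (R : realType) (d : nat) (u : 'rV[R]_d) :
  enorm u ^+ 2 = dotp u u.
Proof. exact/sqr_sqrtr/dotp_ge0. Qed.

Lemma enorm_ge0 (R : realType) (d : nat) (u : 'rV[R]_d) : 0 <= enorm u.
Proof. exact: sqrtr_ge0. Qed.

Lemma enormZ (R : realType) (d : nat) (a : R) (u : 'rV[R]_d) :
  enorm (a *: u) = `|a| * enorm u.
Proof.
by rewrite /enorm dotpZl dotpC dotpZl mulrA -expr2 sqrtrM ?sqr_ge0 // sqrtr_sqr.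
Qed.

Lemma coord_le_enorm (R : realType) (d : nat) (u : 'rV[R]_d) (j : 'I_d) :
  `|u 0 j| <= enorm u.
Proof.
rewrite -(@ler_pXn2r _ 2) ?nnegrE ?enorm_ge0 // enorm_sq real_normK ?num_real //.
rewrite /dotp (bigD1 j) //= -expr2 lerDl.
by apply: sumr_ge0 => i _; rewrite -expr2 sqr_ge0.
Qed.

(** Both $|u-v|^2$ and $|u+v|^2$ are nonnegative. The bound makes [dotp (A t) (g t)] integrable as
    soon as the two squared norms are. *)
Lemma normr_dotp_le (R : realType) (d : nat) (u v : 'rV[R]_d) :
  2 * `|dotp u v| <= dotp u u + dotp v v.
Proof.
have := dotp_ge0 (u - v); have := dotp_ge0 (u - (-1) *: v).
rewrite !dotpBl !(dotpC _ (_ - _)) !dotpBl !dotpZl !(dotpC _ (_ *: _)) !dotpZl.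
rewrite (dotpC v u) => h1 h2.
by case: (ger0P (dotp u v)) => _; lra.
Qed.

(** Cauchy-Schwarz: expand the square of [enorm v *: u - enorm u *: v] and divide by
    [enorm u * enorm v]; vectors of norm zero are treated apart. *)
Lemma dotp_le_enorm (R : realType) (d : nat) (u v : 'rV[R]_d) :
  dotp u v <= enorm u * enorm v.
Proof.
have nz0 (x y : 'rV[R]_d) : enorm x = 0 -> dotp x y = 0.
  move=> x0; rewrite /dotp big1 // => j _.
  have := coord_le_enorm x j; rewrite x0 normr_le0 => /eqP ->.
  by rewrite mul0r.
have [u0|u_neq0] := eqVneq (enorm u) 0; first by rewrite nz0 // u0 mul0r.
have [v0|v_neq0] := eqVneq (enorm v) 0; first by rewrite dotpC nz0 // v0 mulr0.
have uv_gt0 : 0 < enorm u * enorm v.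
  by rewrite mulr_gt0 // lt_neqAle enorm_ge0 eq_sym ?u_neq0 ?v_neq0.
have := dotp_ge0 (enorm v *: u - enorm u *: v).
rewrite !dotpBl !(dotpC _ (_ - _)) !dotpBl !dotpZl !(dotpC _ (_ *: _)) !dotpZl.
rewrite -!enorm_sq (dotpC v u) => h.
rewrite -(ler_pM2l uv_gt0).
have -> : enorm u * enorm v * dotp u v = enorm v * (enorm u * dotp u v) by ring.
by lra.
Qed.

(** * Gradients and the quadratic upper bound *)

Lemma derive_gradE (R : realType) (d : nat) (f : 'rV[R]_d -> R)
    (v u : 'rV[R]_d) :
  differentiable f v -> 'D_u f v = dotp (grad f v) u.
Proof.
move=> df; rewrite deriveE // [in LHS](row_sum_delta u) linear_sum /=.
rewrite /dotp; apply: eq_bigr => j _.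
by rewrite linearZ /= mxE deriveE // [LHS]mulrC.
Qed.

Lemma is_derive_line (R : realType) (d : nat) (f : 'rV[R]_d -> R)
    (v u : 'rV[R]_d) (t : R) : differentiable f (v + t *: u) ->
  is_derive t (1 : R) (fun s : R => f (v + s *: u))
    (dotp (grad f (v + t *: u)) u).
Proof.
move=> df.
(* The difference quotient at [t] along the line equals the directional one at [v + t *: u], so the
   directional derivative carries over. *)
have quotE : (fun h : R => h^-1 *: (f (v + (h *: (1 : R) + t) *: u) - f (v + t *: u)))
    = (fun h : R => h^-1 *: (f (h *: u + (v + t *: u)) - f (v + t *: u))).
  apply/funext => h; congr (_ *: (f _ - _)).
  by rewrite scalerDl [h *: 1]mulr1 addrCA.
have dd := @diff_derivable _ _ _ f _ u df.
apply: DeriveDef.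
- by rewrite /derivable /= quotE.
- by rewrite -derive_gradE // /derive /= quotE.
Qed.

(* Along the segment, the gap to the quadratic upper model is nonincreasing. *)
Lemma L_smooth_quadratic_bound (R : realType) (d : nat) (L : R)
    (f : 'rV[R]_d -> R) (v u : 'rV[R]_d) : L_smooth L f ->
  f (v + u) <= f v + dotp (grad f v) u + L / 2 * enorm u ^+ 2.
Proof.
move=> [df _ Lf].
pose c := dotp (grad f v) u; pose e := L / 2 * enorm u ^+ 2.
(* Since [phi 0] is [f v] and [phi 1] is [f (v + u) - c - e], the claim is [phi 1 <= phi 0]. *)
pose phi (t : R) := f (v + t *: u) - (t * c + t ^+ 2 * e).
pose phi' (t : R) := dotp (grad f (v + t *: u)) u - (c + (2 * t) * e).
have dphi (t : R) : is_derive t (1 : R) phi (phi' t).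
  have h1 := is_derive_line (df (v + t *: u)).
  have h2 : is_derive t (1 : R) (fun t : R => t * c + t ^+ 2 * e) (c + (2 * t) * e).
    apply: is_derive_eq.
    by rewrite !(scaler0, addr0, scaler1, add0r) /GRing.scale /=; ring.
  exact: is_deriveB.
have mono : {in `[0, 1] &, {homo phi : x y /~ x <= y}}.
  apply: ler0_derive1_le_cc.
  - by move=> x _; exact: (@ex_derive _ _ _ _ _ _ _ (dphi x)).
  - move=> x; rewrite in_itv /= => /andP[x0 _].
    rewrite derive1E (@derive_val _ _ _ _ _ _ _ (dphi x)) /phi' /e.
    (* Cauchy-Schwarz and the Lipschitz bound give $\langle\nabla f(v+xu)-\nabla f(v),u\rangle\le
       Lx|u|^2$, which is [2 * x * e]; hence the derivative of [phi] is nonpositive. *)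
    have h1 := dotp_le_enorm (grad f (v + x *: u) - grad f v) u.
    have h2 := Lf (v + x *: u) v.
    rewrite addrAC subrr add0r enormZ (gtr0_norm x0) in h2.
    have h3 := le_trans h1 (ler_wpM2r (enorm_ge0 u) h2).
    by rewrite dotpBl -/c in h3; nra.
  - apply: continuous_subspaceT => x.
    apply: differentiable_continuous; apply/derivable1_diffP.
    exact: (@ex_derive _ _ _ _ _ _ _ (dphi x)).
have := mono 1 0; rewrite !in_itv /= !lexx ler01 => /(_ isT isT isT).
rewrite /phi scale1r scale0r addr0 expr0n /= !mul0r addr0 subr0 expr1n !mul1r.
by rewrite -/c -/e; lra.
Qed.

(** * Step approximation and integrals of real functions *)

Lemma step_count_approx (R : realDomainType) (c x : R) (n : nat) :
  0 < c -> 0 <= x <= n%:R * c ->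
  `|x - c * \sum_(j < n) (j.+1%:R * c <= x)%R%:R| <= c.
Proof.
(* As [x <= n * c], [N n] counts all multiples of [c] in $(0,x]$, so it is the integer part of
   $x/c$, and multiplying back by [c] loses less than [c]. *)
move=> c0 /andP[x0]; pose N k : R := \sum_(j < k) (j.+1%:R * c <= x)%R%:R.
have full k : k%:R * c <= x -> N k = k%:R.
  move=> kx; rewrite /N (eq_bigr (fun=> 1)) ?sumr_const ?card_ord // => j _.
  by rewrite (le_trans _ kx) // ler_pM2r // ler_nat.
rewrite -/(N n); elim: n => [|n IH].
  rewrite mul0r /N big_ord0 mulr0 subr0 => xle0.
  by rewrite ger0_norm // (le_trans xle0) // ltW.
have [xn _|nx] := leP x (n%:R * c); last first.
  have [xS|Sx] := ltP x (n.+1%:R * c).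
    move=> _; rewrite /N big_ord_recr /= -/(N n) (leNgt (_ * c)) xS addr0.
    rewrite full; last exact: ltW.
    by rewrite -natr1 in xS; rewrite ger0_norm; lra.
  move=> xS; rewrite full // (_ : x = n.+1%:R * c); last by apply/eqP; rewrite eq_le xS.
  by rewrite [c * _]mulrC subrr normr0 ltW.
rewrite /N big_ord_recr /= -/(N n).
rewrite (leNgt (_ * c)) (le_lt_trans xn) ?addr0; first exact: IH.
by rewrite ltr_pM2r // ltr_nat.
Qed.

Section RealIntegrable.
Context (dT : measure_display) (T : measurableType dT) (R : realType).
Variable P : probability T R.

Local Notation Rintegrable f := (P.-integrable setT (EFin \o f)).

Lemma Rintegrable_add (f g : T -> R) :
  Rintegrable f -> Rintegrable g -> Rintegrable (fun t => f t + g t).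
Proof. by move=> hf hg; exact: (integrableD measurableT hf hg). Qed.

Lemma Rintegrable_scale (k : R) (f : T -> R) :
  Rintegrable f -> Rintegrable (fun t => k * f t).
Proof. by move=> hf; exact: (integrableZl measurableT k hf). Qed.

Lemma Rintegrable_sub (f g : T -> R) :
  Rintegrable f -> Rintegrable g -> Rintegrable (fun t => f t - g t).
Proof. by move=> hf hg; exact: (integrableB measurableT hf hg). Qed.

Lemma Rintegrable_cst (k : R) : Rintegrable (fun=> k).
Proof. exact: finite_measure_integrable_cst. Qed.

Lemma Rintegrable_measurable (f : T -> R) : Rintegrable f -> measurable_fun setT f.
Proof. by move=> /measurable_int /measurable_EFinP. Qed.

Lemma Rintegrable_dominated (f g : T -> R) : measurable_fun setT f ->
  (forall t, `|f t| <= g t) -> Rintegrable g -> Rintegrable f.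
Proof.
move=> mf fg; apply: le_integrable => //; first exact/measurable_EFinP.
by move=> t _; rewrite lee_fin (le_trans (fg t)) // ler_norm.
Qed.

Lemma Rintegrable_mul_bounded (M : R) (h f : T -> R) : measurable_fun setT h ->
  (forall t, `|h t| <= M) -> Rintegrable f -> Rintegrable (fun t => h t * f t).
Proof.
move=> mh hM hf; apply: (Rintegrable_dominated (g := fun t => M * `|f t|)).
- exact: measurable_funM (Rintegrable_measurable hf).
- by move=> t; rewrite normrM ler_wpM2r.
- exact/Rintegrable_scale/integrable_norm.
Qed.

Lemma Rintegrable_sum (I : Type) (r : seq I) (f : I -> T -> R) :
  (forall i, Rintegrable (f i)) -> Rintegrable (fun t => \sum_(i <- r) f i t).
Proof.
move=> hf; rewrite (_ : _ \o _ = fun t => (\sum_(i <- r) (f i t)%:E)%E).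
  by apply: integrable_sum => // i _; exact: hf.
by apply/funext => t; rewrite sumEFin.
Qed.

Lemma Rintegral_sum (I : Type) (r : seq I) (f : I -> T -> R) :
  (forall i, Rintegrable (f i)) ->
  \int[P]_t (\sum_(i <- r) f i t) = \sum_(i <- r) \int[P]_t f i t.
Proof.
move=> hf; elim: r => [|i r IH].
  have -> : (fun t => \sum_(i <- [::]) f i t) = cst 0.
    by apply/funext => t; rewrite big_nil.
  by rewrite Rintegral_cst // mul0r big_nil.
have -> : (fun t => \sum_(j <- i :: r) f j t) =
    fun t => f i t + \sum_(j <- r) f j t.
  by apply/funext => t; rewrite big_cons.
by rewrite big_cons RintegralD ?IH //; exact: Rintegrable_sum.
Qed.

End RealIntegrable.

(* [H] is approximated uniformly within [M / n] by
   [M / n * \sum_(j < n) \1_{H >= (j + 1) * M / n}]. *)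
Lemma Rintegral_mul_eq0 (dT : measure_display) (T : measurableType dT)
    (R : realType) (P : probability T R) (F : set (set T)) (H V : T -> R)
    (M : R) : F `<=` measurable -> measurable_wrt F measurable H ->
  0 < M -> (forall t, 0 <= H t <= M) ->
  P.-integrable setT (EFin \o V) ->
  (forall D, F D -> (\int[P]_(t in D) (V t)%:E = 0)%E) ->
  \int[P]_t (H t * V t) = 0.
Proof.
move=> FM mH M0 HM iV V0.
(* The superlevel sets of [H] lie in [F], so [V] integrates to zero over each of them, and [V] times
   a step function built from them has integral zero. *)
pose D (c : R) (j : nat) := [set t | j.+1%:R * c <= H t].
have FD c j : F (D c j).
  apply: mH; exists `[j.+1%:R * c, +oo[%classic; first exact: measurable_itv.
  by rewrite setTI; apply/seteqP; split => t /=; rewrite /D /= in_itv /= andbT.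
have mHT : measurable_fun setT H.
  by move=> _ B mB; apply: FM; apply: mH; exists B.
have iHV : P.-integrable setT (EFin \o (fun t => H t * V t)).
  apply: (Rintegrable_mul_bounded (M := M)) => // t.
  by have /andP[h0 h1] := HM t; rewrite ger0_norm.
pose N (c : R) n t : R := \sum_(j < n) (j.+1%:R * c <= H t)%R%:R.
have restrictE (c : R) (j : nat) :
    (fun t : T => (j.+1%:R * c <= H t)%R%:R * V t) = V \_ (D c j).
  apply/funext => t; rewrite patchE.
  case: ifPn => [|]; [rewrite inE|rewrite notin_setE] => h.
    by rewrite h mul1r.
  by case: leP => // _; rewrite mul0r.
have iD c j : P.-integrable setT
    (EFin \o (fun t : T => (j.+1%:R * c <= H t)%R%:R * V t)).
  have mD : measurable (D c j) by exact: (FM _ (FD _ _)).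
  rewrite restrictE -restrict_EFin; apply/(integrable_mkcond _ mD).
  exact: (integrableS measurableT mD (@subsetT _ _) iV).
have NE c n : (fun t => N c n t * V t) =
    (fun t => \sum_(j < n) ((j.+1%:R * c <= H t)%R%:R * V t)).
  by apply/funext => t; rewrite /N mulr_suml.
have iN c n : P.-integrable setT (EFin \o (fun t => N c n t * V t)).
  by rewrite NE; apply: Rintegrable_sum => j; exact: iD.
have N0 c n : \int[P]_t (N c n t * V t) = 0.
  rewrite NE Rintegral_sum; last by move=> j; exact: iD.
  rewrite big1 // => j _; rewrite restrictE -Rintegral_mkcond /Rintegral V0 //.
(* Replacing [H] by its step approximation changes the integral by at most [c] times that of $|V|$,
   and the integral after replacement vanishes by [N0]. *)
have bound (c : R) (n : nat) : 0 < c -> n%:R * c = M ->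
    `|\int[P]_t (H t * V t)| <= c * \int[P]_t `|V t|.
  move=> c0 cM.
  rewrite -[\int[P]_t (H t * V t)]subr0 -[X in _ - X](mulr0 c) -(N0 c n).
  rewrite -RintegralZl // -RintegralB //; last exact: Rintegrable_scale.
  apply: le_trans (le_normr_Rintegral _ _) _ => //.
    exact/Rintegrable_sub/Rintegrable_scale.
  rewrite -RintegralZl //; last exact: integrable_norm.
  apply: le_Rintegral => //.
  - exact/integrable_norm/Rintegrable_sub/Rintegrable_scale.
  - exact/Rintegrable_scale/integrable_norm.
  move=> t _; rewrite mulrA -mulrBl normrM ler_wpM2r //.
  by apply: step_count_approx => //; rewrite cM.
apply/eqP; rewrite -normr_le0; apply/ler_addgt0Pr => e e0; rewrite add0r.
set I := \int[P]_t `|V t| in bound.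
have I0 : 0 <= I by apply: Rintegral_ge0.
(* With [c = M / n] the bound is $MI/n$, which is at most [e] once $n > MI/e$; the successor also
   keeps [n] nonzero. *)
pose n := (Num.trunc (M * I / e)).+1.
have n0 : 0 < n%:R :> R by rewrite ltr0n.
apply: le_trans (bound (M / n%:R) n _ _) _.
- by rewrite divr_gt0.
- by rewrite mulrC divfK // gt_eqF.
rewrite mulrAC ler_pdivrMr // [e * _]mulrC -ler_pdivrMr //.
by rewrite ltW // truncnS_gt.
Qed.

(** * Continuity, measurability and conditional expectation *)

Lemma continuous_sum (R : realType) (U : topologicalType) (I : Type)
    (r : seq I) (h : I -> U -> R) : (forall i, continuous (h i)) ->
  continuous (fun v => \sum_(i <- r) h i v).
Proof.
move=> ch v; elim: r => [|i r IH].
  have -> : (fun v => \sum_(i <- [::]) h i v) = cst 0.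
    by apply/funext => u; rewrite big_nil.
  exact: cvg_cst.
have -> : (fun v => \sum_(j <- i :: r) h j v) =
    h i \+ (fun v => \sum_(j <- r) h j v).
  by apply/funext => u; rewrite big_cons.
by apply: continuousD => //; exact: ch.
Qed.

Lemma continuous_dotp (R : realType) (d : nat) (U : topologicalType)
    (f g : U -> 'rV[R]_d) : (forall j, continuous (fun v => f v 0 j)) ->
  (forall j, continuous (fun v => g v 0 j)) ->
  continuous (fun v => dotp (f v) (g v)).
Proof.
move=> cf cg; apply: continuous_sum => j v.
exact: continuousM (cf j v) (cg j v).
Qed.

(** Open intervals generate the Borel sets of the line and have open preimages under [h], so
    measurability of [h] for [borel] can be tested on these generators. *)
Lemma measurable_wrt_continuous (R : realType) (d : nat) (T : Type)
    (F : set (set T)) (w : T -> 'rV[R]_d) (h : 'rV[R]_d -> R) :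
  continuous h -> measurable_wrt F (borel R d) w ->
  measurable_wrt F measurable (h \o w).
Proof.
move=> /continuousP ch mw _ [B mB <-]; apply: mw; exists (h @^-1` B) => //.
have mh : measurable_fun setT (h : g_sigma_algebraType (@open 'rV[R]_d) -> R).
  apply: (measurability _ (RGenOpens.measurableE R)).
  move=> _ [_ [a [b ->] <-]]; rewrite setTI.
  apply: sub_sigma_algebra; apply: ch; exact: interval_open.
by have := mh measurableT B mB; rewrite setTI.
Qed.

Lemma measurable_wrt_measurable_fun (dT : measure_display)
    (T : measurableType dT) (R : realType) (F : set (set T)) (h : T -> R) :
  F `<=` measurable -> measurable_wrt F measurable h -> measurable_fun setT h.
Proof. by move=> FM mh _ B mB; apply: FM; apply: mh; exists B. Qed.

(** On a null set [f] may be negative; its positive part has the same integral and is nonnegative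
    everywhere. *)
Lemma ae_Rintegral_ge0 (dT : measure_display) (T : measurableType dT)
    (R : realType) (P : probability T R) (f : T -> R) :
  measurable_fun setT f -> {ae P, forall t, 0 <= f t} -> 0 <= \int[P]_t f t.
Proof.
move=> mf f0; have mf' : measurable_fun setT (fun t => Num.max (f t) 0).
  exact: measurable_maxr.
have -> : \int[P]_t f t = \int[P]_t (Num.max (f t) 0).
  congr fine; apply: ae_eq_integral => //; [exact/measurable_EFinP..|].
  by apply: filterS f0 => t /= ft _; rewrite max_l.
by apply: Rintegral_ge0 => t _; rewrite le_max lexx orbT.
Qed.

(** [X - Y] integrates to zero over every set of [F], so [Rintegral_mul_eq0] applies to it with the
    weight [H + M], shifted to take values in $[0,2M]$. The shift contributes [M] times the integral
    of [X - Y], which is zero. *)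
Lemma condexp_pull_out_bounded (dT : measure_display) (T : measurableType dT)
    (R : realType) (P : probability T R) (F : set (set T)) (H X Y : T -> R)
    (M : R) : F `<=` measurable -> measurable_wrt F measurable H ->
  0 < M -> (forall t, `|H t| <= M) -> is_condexp P F X Y ->
  \int[P]_t (H t * X t) = \int[P]_t (H t * Y t).
Proof.
move=> FM mH M0 HM [iX iY _ XY].
have mHT := measurable_wrt_measurable_fun FM mH.
have FT : F setT by apply: mH; exists setT => //; rewrite setTI.
have iV := Rintegrable_sub iX iY.
have V0 D : F D -> (\int[P]_(t in D) (X t - Y t)%:E = 0)%E.
  move=> FD; have mD := FM _ FD.
  have iXD := integrableS measurableT mD (@subsetT _ _) iX.
  have iYD := integrableS measurableT mD (@subsetT _ _) iY.
  under eq_integral do rewrite EFinB.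
  by rewrite integralB_EFin // XY // subee // integrable_fin_num.
have mHM : measurable_wrt F measurable (fun t => H t + M).
  have m : measurable_fun setT (fun x : R => x + M) by exact: measurable_funD.
  move=> _ [B mB <-]; apply: mH; exists ((fun x => x + M) @^-1` B) => //.
  by rewrite -[X in measurable X]setTI; exact: m.
have := @Rintegral_mul_eq0 _ _ _ P F _ _ (2 * M) FM mHM _ _ iV V0.
have -> : (fun t => (H t + M) * (X t - Y t)) =
    fun t => (H t * X t - H t * Y t) + M * (X t - Y t).
  by apply/funext => t; ring.
have iHX := Rintegrable_mul_bounded mHT HM iX.
have iHY := Rintegrable_mul_bounded mHT HM iY.
rewrite RintegralD //; [|exact: Rintegrable_sub|exact: Rintegrable_scale].
have V0T : \int[P]_t (X t - Y t) = 0 by rewrite /Rintegral V0.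
rewrite RintegralZl // V0T mulr0 addr0 RintegralB //.
move=> /(_ _ _)/subr0_eq; apply; first by rewrite mulr_gt0.
by move=> t; have := HM t; rewrite ler_norml => /andP[]; lra.
Qed.

(* [EA] is not known to be square integrable, so the conditioning identity is
   applied after multiplying by the bounded continuous
   weights [1 / (1 + |gr w|^2 / (n + 1))], which increase to 1. *)
Lemma condexp_dotp_ge (dT : measure_display) (T : measurableType dT)
    (R : realType) (P : probability T R) (F : set (set T)) (d : nat)
    (A EA w : T -> 'rV[R]_d) (gr : 'rV[R]_d -> 'rV[R]_d) (kappa : R) :
  F `<=` measurable -> measurable_wrt F (borel R d) w ->
  (forall j, continuous (fun v => gr v 0 j)) -> is_condexp_vec P F A EA ->
  {ae P, forall t, kappa * enorm (gr (w t)) ^+ 2 <= dotp (EA t) (gr (w t))} ->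
  P.-integrable setT (fun t => (dotp (gr (w t)) (gr (w t)))%:E) ->
  P.-integrable setT (fun t => (dotp (A t) (gr (w t)))%:E) ->
  kappa * \int[P]_t dotp (gr (w t)) (gr (w t)) <=
    \int[P]_t dotp (A t) (gr (w t)).
Proof.
move=> FM mw cgr cA angle igg iAg.
pose s v := dotp (gr v) (gr v).
have s0 v : 0 <= s v by exact: dotp_ge0.
have cs : continuous s by exact: continuous_dotp.
pose den n v : R := 1 + n.+1%:R^-1 * s v.
have den_ge1 n v : 1 <= den n v by rewrite lerDl mulr_ge0.
have den_gt0 n v : 0 < den n v by apply: lt_le_trans (den_ge1 n v).
pose chi n v := (den n v)^-1.
have chi_ge0 n v : 0 <= chi n v by rewrite invr_ge0 ltW.
have chi_le1 n v : chi n v <= 1 by rewrite invf_le1.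
have cchi n : continuous (chi n).
  move=> v; apply: continuousV; first by rewrite gt_eqF.
  apply: continuousD; first exact: cst_continuous.
  by apply: continuousM; [exact: cst_continuous|exact: cs].
pose H n j t := chi n (w t) * gr (w t) 0 j.
have mH n j : measurable_wrt F measurable (H n j).
  apply: (@measurable_wrt_continuous _ _ _ _ w (fun v => chi n v * gr v 0 j)) => // v.
  by apply: continuousM; [exact: cchi|exact: cgr].
(* The product of [n.+1] and [den n v] is [n.+1 + s v], and a coordinate of the gradient is at most
   its norm $e\le 1+e^2$. *)
have HM n j t : `|H n j t| <= n.+1%:R.
  rewrite normrM ger0_norm // mulrC ler_pdivrMr // /den mulrDr mulr1 mulrA.
  rewrite divff ?mul1r ?pnatr_eq0 //.
  apply: (@le_trans _ _ (1 + s (w t))); last by rewrite lerD2r ler1n.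
  have := coord_le_enorm (gr (w t)) j; rewrite -/s => h.
  have := enorm_sq (gr (w t)); rewrite -/(s _) => <-.
  by have := sqr_ge0 (enorm (gr (w t)) - 1); nra.
have mHT n j := measurable_wrt_measurable_fun FM (mH n j).
have chi_dotp n (X : T -> 'rV[R]_d) t :
    chi n (w t) * dotp (X t) (gr (w t)) = \sum_j H n j t * X t 0 j.
  by rewrite /dotp mulr_sumr; apply: eq_bigr => j _; rewrite /H; ring.
have iHA n j : P.-integrable setT (EFin \o (fun t => H n j t * A t 0 j)).
  by have [iA _ _ _] := cA j; exact: (Rintegrable_mul_bounded (mHT n j) (HM n j)).
have iHE n j : P.-integrable setT (EFin \o (fun t => H n j t * EA t 0 j)).
  by have [_ iE _ _] := cA j; exact: (Rintegrable_mul_bounded (mHT n j) (HM n j)).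
have swap n : \int[P]_t (\sum_j H n j t * A t 0 j) =
    \int[P]_t (\sum_j H n j t * EA t 0 j).
  rewrite !Rintegral_sum //; apply: eq_bigr => j _.
  exact: (condexp_pull_out_bounded FM (mH n j) _ (HM n j) (cA j)).
pose h t := dotp (A t) (gr (w t)) - kappa * s (w t).
have ih : P.-integrable setT (EFin \o h) by apply/Rintegrable_sub/Rintegrable_scale.
have mchi n : measurable_fun setT (fun t => chi n (w t)).
  exact: measurable_wrt_measurable_fun FM (measurable_wrt_continuous (cchi n) mw).
have ichi n f : P.-integrable setT (EFin \o f) ->
    P.-integrable setT (EFin \o (fun t => chi n (w t) * f t)).
  by apply: (Rintegrable_mul_bounded (mchi n)) => t; rewrite ger0_norm.
(* Under a bounded weight [A] may be exchanged for [EA], for which the angle inequality holds almost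
   everywhere. *)
have chi_h_ge0 n : 0 <= \int[P]_t (chi n (w t) * h t).
  have -> : (fun t => chi n (w t) * h t) =
      fun t => \sum_j H n j t * A t 0 j - chi n (w t) * (kappa * s (w t)).
    by apply/funext => t; rewrite -chi_dotp mulrBr.
  rewrite RintegralB //; [|exact: Rintegrable_sum|exact/ichi/Rintegrable_scale].
  rewrite swap -RintegralB //; [|exact: Rintegrable_sum|exact/ichi/Rintegrable_scale].
  apply: ae_Rintegral_ge0.
    apply: Rintegrable_measurable; apply: Rintegrable_sub; [exact: Rintegrable_sum|].
    exact/ichi/Rintegrable_scale.
  apply: filterS angle => t /= ang.
  by rewrite -chi_dotp -mulrBr mulr_ge0 // subr_ge0 /s -enorm_sq.
have mh := Rintegrable_measurable ih.
(* For fixed [t] the weights tend to 1, and they stay in $[0,1]$, so $|h|$ dominates and the sign of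
   the weighted integrals passes to the integral of [h]. *)
have [_ _ lim] : [/\ P.-integrable setT (EFin \o h),
    [sequence (\int[P]_t `|(chi n (w t) * h t)%:E - (h t)%:E|)%E]_n @ \oo --> 0%E
  & [sequence (\int[P]_t (chi n (w t) * h t)%:E)%E]_n @ \oo -->
      (\int[P]_t (EFin \o h) t)%E].
  apply: (@dominated_convergence _ _ _ P _ measurableT
    (fun n t => (chi n (w t) * h t)%:E) (EFin \o h) (EFin \o (fun t => `|h t|))).
  - by move=> n; apply/measurable_EFinP; exact: measurable_funM.
  - exact/measurable_EFinP.
  - apply: aeW => t _; apply: cvg_EFin; first exact: nearW.
    rewrite -[X in _ --> X]mul1r; apply: cvgM; last exact: cvg_cst.
    rewrite -[X in _ --> X]invr1; apply: cvgV; first by rewrite oner_eq0.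
    rewrite -[X in _ --> X]addr0; apply: cvgD; first exact: cvg_cst.
    rewrite -[X in _ --> X](mul0r (s (w t))); apply: cvgM; last exact: cvg_cst.
    exact: cvg_harmonic.
  - exact: integrable_norm.
  - apply: aeW => t n _; rewrite lee_fin normrM ger0_norm //.
    by rewrite ler_piMl.
have : 0 <= \int[P]_t h t.
  rewrite fine_ge0 // -(cvg_lim _ lim) //; apply: lime_ge.
    by apply/cvg_ex; eexists; exact: lim.
  apply: nearW => n /=; rewrite -[leRHS]fineK; last first.
    by apply: integrable_fin_num => //; exact: ichi.
  by rewrite lee_fin; exact: chi_h_ge0.
by rewrite RintegralB ?RintegralZl ?subr_ge0 //; exact: Rintegrable_scale.
Qed.

(** * Deterministic recursions with square-summable or nonincreasing step sizes *)

(* Discounting by [expR (- p * \sum_(j < k) al j ^+ 2)] turns the recursion into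
   a telescoping one. *)
Lemma perturbed_descent_summable (R : realType) (D x al : nat -> R) (p r S : R) :
  0 <= p -> 0 <= r -> (forall k, 0 <= D k) -> (forall k, 0 <= x k) ->
  (forall K, \sum_(0 <= k < K) al k ^+ 2 <= S) ->
  (forall k, D k.+1 + x k <= (1 + p * al k ^+ 2) * D k + r * al k ^+ 2) ->
  exists2 C, 0 <= C & forall K, \sum_(0 <= k < K) x k <= C.
Proof.
move=> p0 r0 D0 x0 alS step.
pose s k := \sum_(0 <= j < k) al j ^+ 2.
have sS k : s k.+1 = s k + al k ^+ 2 by rewrite /s big_nat_recr.
have s0 k : 0 <= s k by apply: sumr_ge0 => j _; exact: sqr_ge0.
pose b k := expR (- (p * s k)).
have b_gt0 k : 0 < b k by exact: expR_gt0.
have b_le1 k : b k <= 1 by rewrite -expR0 ler_expR oppr_le0 mulr_ge0.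
have b_ge k : expR (- (p * S)) <= b k.
  by rewrite ler_expR lerN2 ler_wpM2l // alS.
(* The inequality $1+u\le e^u$ lets one discount factor cancel the growth of one step. *)
have b_step k : b k.+1 * (1 + p * al k ^+ 2) <= b k.
  have -> : b k = b k.+1 * expR (p * al k ^+ 2).
    by rewrite /b -expRD sS; congr expR; ring.
  by rewrite ler_pM2l // expR_ge1Dx.
(* The discount stays exact on [D], is replaced by its uniform lower bound on the [x k], and by its
   upper bound 1 on the noise terms. *)
have tele K : b K * D K + expR (- (p * S)) * \sum_(0 <= k < K) x k <=
    D 0%N + r * s K.
  elim: K => [|K IH].
    by rewrite big_nil mulr0 addr0 /s big_nil mulr0 addr0 ler_piMl.
  rewrite big_nat_recr //= sS.
  have h1 : b K.+1 * (D K.+1 + x K) <=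
      b K.+1 * ((1 + p * al K ^+ 2) * D K + r * al K ^+ 2).
    by rewrite ler_pM2l.
  have h2 := ler_wpM2r (D0 K) (b_step K).
  have h3 := ler_wpM2r (x0 K) (b_ge K.+1).
  have h4 : b K.+1 * (r * al K ^+ 2) <= r * al K ^+ 2.
    by rewrite ler_piMl // mulr_ge0 // sqr_ge0.
  lra.
have S0 : 0 <= S by apply: le_trans (alS 0%N); rewrite big_nil.
(* Dropping the nonnegative [b K * D K] in [tele] and dividing by [expR (- (p * S))] gives this
   constant. *)
exists (expR (p * S) * (D 0%N + r * S)).
  by rewrite mulr_ge0 ?expR_ge0 // addr_ge0 // mulr_ge0.
move=> K; have := tele K; rewrite expRN => h.
rewrite -ler_pdivrMl ?expR_gt0 //; apply: le_trans (le_trans _ h) _.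
  by rewrite lerDr mulr_ge0 // ltW.
by rewrite lerD2l ler_wpM2l // alS.
Qed.

(** Otherwise each of the [K] terms would exceed $C/K$, because every weight up to index [K.-1] is
    at least [al K.-1], and the sum would exceed [C]. *)
Lemma exists_le_of_weighted_sum_le (R : realType) (x al : nat -> R) (C : R)
    (K : nat) : (forall k, 0 < al k) -> (forall k, al k.+1 <= al k) ->
  (forall k, 0 <= x k) ->
  (0 < K)%N -> \sum_(0 <= k < K) al k * x k <= C ->
  exists2 k, (k < K)%N & x k <= C * (K%:R * al K.-1)^-1.
Proof.
move=> al0 al_noninc x0 K0 sumC.
have al_last k : (k < K)%N -> al K.-1 <= al k.
  move=> kK; have := nonincreasing_seqP al; case=> /(_ al_noninc) noninc _.
  by apply: noninc; rewrite -ltnS prednK.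
apply: contrapT => noK.
have big k : (k < K)%N -> C * (K%:R * al K.-1)^-1 < x k.
  by move=> kK; rewrite ltNge; apply/negP => h; apply: noK; exists k.
suff : C < \sum_(0 <= k < K) al k * x k by rewrite ltNge sumC.
have -> : C = \sum_(0 <= k < K) al K.-1 * (C * (K%:R * al K.-1)^-1).
  rewrite sumr_const_nat subn0 -mulr_natr invfM.
  by field; rewrite !gt_eqF ?ltr0n.
apply: ltr_sum_nat => // k /andP[_ kK].
apply: lt_le_trans (_ : al K.-1 * x k <= _); first by rewrite ltr_pM2l // big.
by rewrite ler_wpM2r // al_last.
Qed.

(** * One step of the algorithm in expectation *)

Lemma Rintegrable_of_integral_le (dT : measure_display) (T : measurableType dT)
    (R : realType) (P : probability T R) (f g : T -> R) :
  measurable_fun setT f -> (forall t, 0 <= f t) ->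
  P.-integrable setT (EFin \o g) ->
  (\int[P]_t (f t)%:E <= \int[P]_t (g t)%:E)%E ->
  P.-integrable setT (EFin \o f) /\ \int[P]_t f t <= \int[P]_t g t.
Proof.
move=> mf f0 ig fg; have ifi : P.-integrable setT (EFin \o f).
  apply/integrableP; split; first exact/measurable_EFinP.
  under eq_integral do rewrite /= ger0_norm //.
  by apply: le_lt_trans fg _; exact: integrable_lty.
by split=> //; rewrite fine_le // integrable_fin_num.
Qed.

(** A gradient step of size $1/L$ lowers [f] by at least $|\nabla f|^2/(2L)$ but cannot go below
    [Flow]. This derives square integrability of the gradient from integrability of the objective
    gap. *)
Lemma quadratic_bound_grad_le (R : realType) (d : nat) (L Flow : R)
    (f : 'rV[R]_d -> R) (v : 'rV[R]_d) : 0 < L ->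
  (forall v u, f (v + u) <= f v + dotp (grad f v) u + L / 2 * dotp u u) ->
  (forall v, Flow <= f v) ->
  dotp (grad f v) (grad f v) <= 2 * L * (f v - Flow).
Proof.
move=> L0 quad low; have := quad v (- L^-1 *: grad f v).
rewrite !dotpZl (dotpC (grad f v)) !dotpZl.
have := low (v + - L^-1 *: grad f v).
set e := dotp _ _ => h1 h2; have := le_trans h1 h2.
have -> : f v + - L^-1 * e + L / 2 * (- L^-1 * (- L^-1 * e)) =
    f v - e / (2 * L) by field; rewrite gt_eqF.
by rewrite lerBrDl -lerBrDr ler_pdivrMr ?mulr_gt0 //; lra.
Qed.

(** The quadratic bound at the displacement [- al *: A t] is integrated. Integrability is obtained
    in turn for the squared gradient, the squared norm of [A], their inner product and the next gap;
    the last makes the lemma iterable. *)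
Lemma expected_descent (dT : measure_display) (T : measurableType dT)
    (R : realType) (P : probability T R) (S : set (set T)) (d : nat)
    (f : 'rV[R]_d -> R) (L Flow al kappa cA cB cC cE : R)
    (w w' A EA : T -> 'rV[R]_d) (MA : T -> \bar R) :
  S `<=` measurable -> measurable_wrt S (borel R d) w ->
  measurable_fun setT (fun t => f (w' t)) ->
  (forall t, w' t = w t - al *: A t) ->
  is_condexp_vec P S A EA ->
  is_condexp_nneg P S (fun t => (enorm (A t) ^+ 2)%:E) MA ->
  continuous f -> (forall j, continuous (fun v => grad f v 0 j)) ->
  (forall v u, f (v + u) <= f v + dotp (grad f v) u + L / 2 * dotp u u) ->
  (forall v, Flow <= f v) ->
  0 < L -> 0 < al -> 0 <= kappa -> 0 <= cA -> 0 <= cB -> 0 <= cC -> 0 <= cE ->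
  al * (L * (cB * cE)) <= kappa ->
  {ae P, forall t,
    kappa * enorm (grad f (w t)) ^+ 2 <= dotp (EA t) (grad f (w t))} ->
  {ae P, forall t, (MA t <= (cE * (2 * cA * (f (w t) - Flow) +
     cB * enorm (grad f (w t)) ^+ 2 + cC))%:E)%E} ->
  P.-integrable setT (EFin \o (fun t => f (w t) - Flow)) ->
  [/\ P.-integrable setT (EFin \o (fun t => f (w' t) - Flow)),
      P.-integrable setT
        (EFin \o (fun t => dotp (grad f (w t)) (grad f (w t)))) &
      \int[P]_t (f (w' t) - Flow) +
        al * (kappa / 2 * \int[P]_t dotp (grad f (w t)) (grad f (w t))) <=
      (1 + L * cE * cA * al ^+ 2) * \int[P]_t (f (w t) - Flow) +
        L * cE * cC / 2 * al ^+ 2].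
Proof.
move=> SM mw mfw' w'E cA_vec [MA0 mMA MAE] cf cg quad low.
move=> L0 al0 kappa0 cA0 cB0 cC0 cE0 al_small angle MAle ifw.
set g := fun t => grad f (w t).
have cgg : continuous (fun v => dotp (grad f v) (grad f v)).
  exact: continuous_dotp.
have mg j : measurable_fun setT (fun t => g t 0 j).
  exact: measurable_wrt_measurable_fun SM (measurable_wrt_continuous (cg j) mw).
have mA j : measurable_fun setT (fun t => A t 0 j).
  by have [iA _ _ _] := cA_vec j; exact: Rintegrable_measurable iA.
have mdotp (X Y : T -> 'rV[R]_d) : (forall j, measurable_fun setT (fun t => X t 0 j)) ->
    (forall j, measurable_fun setT (fun t => Y t 0 j)) ->
    measurable_fun setT (fun t => dotp (X t) (Y t)).
  by move=> mX mY; apply: measurable_sum => j; exact: measurable_funM.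
have igg : P.-integrable setT (EFin \o (fun t => dotp (g t) (g t))).
  apply: Rintegrable_dominated (Rintegrable_scale (2 * L) ifw); first exact: mdotp.
  move=> t; rewrite ger0_norm ?dotp_ge0 //.
  exact: quadratic_bound_grad_le.
have ST : S setT.
  by apply: mMA; exists setT; [exact: measurableT|rewrite setTI].
pose bnd t := cE * (2 * cA * (f (w t) - Flow) + cB * dotp (g t) (g t) + cC).
have ibnd : P.-integrable setT (EFin \o bnd).
  apply: Rintegrable_scale; apply: Rintegrable_add; last exact: Rintegrable_cst.
  by apply: Rintegrable_add; exact: Rintegrable_scale.
(* Conditioning tested on the whole space turns the almost sure bound on [MA] into a bound on the
   second moment of [A], which also yields its integrability. *)
have [iAA AA_le] : P.-integrable setT (EFin \o (fun t => dotp (A t) (A t))) /\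
    \int[P]_t dotp (A t) (A t) <= \int[P]_t bnd t.
  apply: Rintegrable_of_integral_le => //; [exact: mdotp|by move=> t; exact: dotp_ge0|].
  have -> : (\int[P]_t (dotp (A t) (A t))%:E = \int[P]_t MA t)%E.
    by rewrite MAE //; apply: eq_integral => t _; rewrite enorm_sq.
  apply: ae_ge0_le_integral => //.
  - by move=> _ B mB; apply: SM; apply: mMA; exists B.
  - move=> t _; rewrite lee_fin mulr_ge0 // !addr_ge0 // ?mulr_ge0 ?dotp_ge0 //.
    by rewrite subr_ge0.
  - exact: measurable_int ibnd.
  - by apply: filterS MAle => t /= + _; rewrite enorm_sq.
have iAg : P.-integrable setT (EFin \o (fun t => dotp (A t) (g t))).
  apply: (Rintegrable_dominated
    (g := fun t => 2^-1 * (dotp (A t) (A t) + dotp (g t) (g t)))).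
  - exact: mdotp.
  - move=> t; rewrite -ler_pdivrMl ?invr_gt0 // invrK.
    exact: normr_dotp_le.
  - exact/Rintegrable_scale/Rintegrable_add.
have pull : kappa * \int[P]_t dotp (g t) (g t) <= \int[P]_t dotp (A t) (g t).
  exact: condexp_dotp_ge SM mw cg cA_vec angle igg iAg.
pose ub t := f (w t) - Flow - al * dotp (A t) (g t) +
  L / 2 * al ^+ 2 * dotp (A t) (A t).
have iub : P.-integrable setT (EFin \o ub).
  by apply: Rintegrable_add; [apply: Rintegrable_sub => //; exact: Rintegrable_scale|
    exact: Rintegrable_scale].
have ub_ge t : f (w' t) - Flow <= ub t.
  rewrite w'E -scaleNr /ub; have := quad (w t) (- al *: A t).
  rewrite !dotpZl (dotpC (grad f (w t)) (_ *: _)) (dotpC (A t) (_ *: _)) !dotpZl.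
  by rewrite -/(g t); lra.
have ifw' : P.-integrable setT (EFin \o (fun t => f (w' t) - Flow)).
  apply: Rintegrable_dominated iub; first exact: measurable_funB.
  by move=> t; rewrite ger0_norm // subr_ge0.
split=> //.
have main := le_Rintegral measurableT ifw' iub (fun t _ => ub_ge t).
move: main pull AA_le.
set D' := \int[P]_t (f (w' t) - Flow).
pose Dw t := f (w t) - Flow.
have -> : \int[P]_t ub t = \int[P]_t Dw t - al * \int[P]_t dotp (A t) (g t) +
    L / 2 * al ^+ 2 * \int[P]_t dotp (A t) (A t).
  rewrite RintegralD //; [|by apply: Rintegrable_sub => //; exact: Rintegrable_scale|
    exact: Rintegrable_scale].
  rewrite RintegralB //; last exact: Rintegrable_scale.
  by rewrite !RintegralZl.
have -> : \int[P]_t bnd t = cE * (2 * cA * \int[P]_t Dw t +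
    cB * \int[P]_t dotp (g t) (g t) + cC).
  rewrite RintegralZl //; last first.
    by apply: Rintegrable_add; [apply: Rintegrable_add; exact: Rintegrable_scale|
    exact: Rintegrable_cst].
  rewrite RintegralD //; [|by apply: Rintegrable_add; exact: Rintegrable_scale|
    exact: Rintegrable_cst].
  rewrite RintegralD //; [|exact: Rintegrable_scale|exact: Rintegrable_scale].
  have PT : fine (P setT) = 1 by rewrite probability_setT.
  by rewrite !RintegralZl // Rintegral_cst // [fine _]PT mulr1.
set D := \int[P]_t Dw t.
set a := \int[P]_t dotp (g t) (g t); set Ag := \int[P]_t dotp (A t) (g t).
set AA := \int[P]_t dotp (A t) (A t) => main pull AA_le.
have a0 : 0 <= a by apply: Rintegral_ge0 => t _; exact: dotp_ge0.
have h1 : al * (kappa * a) <= al * Ag by rewrite ler_pM2l.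
have h2 : L / 2 * al ^+ 2 * AA <=
    L / 2 * al ^+ 2 * (cE * (2 * cA * D + cB * a + cC)).
  by rewrite ler_wpM2l // !mulr_ge0 // ltW.
(* Half of this inequality absorbs the [cB] part of the second-order term into the descent
   [al * kappa * a], leaving the factor [kappa / 2]. *)
have h3 : al * a * (al * (L * (cB * cE))) <= al * a * kappa.
  by rewrite ler_wpM2l // mulr_ge0 // ltW.
lra.
Qed.

(** * Averaging over nodes and signs of the constants *)

Lemma grad_avg (R : realType) (d m : nat) (Fi : 'I_m -> 'rV[R]_d -> R)
    (F : 'rV[R]_d -> R) (v : 'rV[R]_d) :
  (forall v, F v = m%:R^-1 * \sum_(i < m) Fi i v) ->
  (forall i, differentiable (Fi i) v) ->
  grad F v = m%:R^-1 *: \sum_(i < m) grad (Fi i) v.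
Proof.
move=> FE dFi; have -> : F = m%:R^-1 *: \sum_(i < m) Fi i.
  by apply/funext => u; rewrite FE fctE fct_sumE.
have dD i u : derivable (Fi i) v u by exact: diff_derivable.
apply/rowP => j; rewrite !mxE summxE deriveZ; last exact: derivable_sum.
by rewrite derive_sum //; congr (_ * _); apply: eq_bigr => i _; rewrite mxE.
Qed.

Lemma continuous_avg (R : realType) (U : topologicalType) (m : nat)
    (h : 'I_m -> U -> R) : (forall i, continuous (h i)) ->
  continuous (fun v => m%:R^-1 * \sum_(i < m) h i v).
Proof.
by move=> ch v; apply: cvgM; [exact: cvg_cst|exact: continuous_sum].
Qed.

Lemma past_samples_measurable (dT dZ : measure_display) (T : measurableType dT)
    (Z : measurableType dZ) (m : nat) (zeta : nat -> 'I_m -> T -> Z) (k : nat) :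
  (forall k i, measurable_fun setT (zeta k i)) ->
  past_samples zeta k `<=` measurable.
Proof.
move=> mz; apply: smallest_sub; first exact: sigma_algebra_measurable.
move=> _ [i _ [j _ [B mB <-]]]; exact: mz.
Qed.

(** Sine equal to 1 would force a zero cosine, which is positive on this range. This makes the
    descent factor [kappa] positive. *)
Lemma sin_lt1 (R : realType) (theta : R) :
  0 <= theta -> theta < pi / 2 -> sin theta < 1.
Proof.
move=> t0 t1; rewrite lt_neqAle sin_le1 andbT; apply/negP => /eqP s1.
have c0 : 0 < cos theta.
  by apply: cos_gt0_pihalf; rewrite t1 andbT (lt_le_trans _ t0) //
    oppr_lt0 divr_gt0 // pi_gt0.
have := cos2Dsin2 theta; rewrite s1 => h; nra.
Qed.

(** The Lipschitz bound is tested on the all-ones vector and 0, which are at positive distance when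
    [d] is positive. *)
Lemma L_smooth_ge0 (R : realType) (d : nat) (L : R) (f : 'rV[R]_d -> R) :
  (0 < d)%N -> L_smooth L f -> 0 <= L.
Proof.
case: d f => // d f _ [_ _ Lf].
have := le_trans (enorm_ge0 _) (Lf (const_mx 1) 0).
rewrite subr0 pmulr_lge0 //; apply: lt_le_trans (coord_le_enorm _ ord0).
by rewrite mxE normr1.
Qed.

(** * Convergence of the smallest expected gradient norm *)

Theorem theorem3p4 (R : realType)
  (* nodes, dimension, datasets, loss and model *)
  (m d : nat) (m_gt0 : (0 < m)%N)
  (X Y O : Type) (l : Y -> O -> R) (f : X -> 'rV[R]_d -> O)
  (n : 'I_m -> nat) (n_gt0 : forall i, (0 < n i)%N)
  (x : forall i, 'I_(n i) -> X) (y : forall i, 'I_(n i) -> Y)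
  (Fi : 'I_m -> 'rV[R]_d -> R)
  (FiE : forall i v, Fi i v = empirical_risk l f (x i) (y i) v)
  (F : 'rV[R]_d -> R)
  (FE : forall v, F v = m%:R^-1 * \sum_(i < m) Fi i v)
  (* probability space, samples, gradient model *)
  (dT dZ : measure_display) (T : measurableType dT) (Z : measurableType dZ)
  (P : probability T R)
  (zeta : nat -> 'I_m -> T -> Z)
  (zeta_meas : forall k i, measurable_fun setT (zeta k i))
  (G : 'rV[R]_d -> Z -> 'rV[R]_d)
  (w : nat -> T -> 'rV[R]_d)
  (w_meas : forall k, measurable_wrt (past_samples zeta k) (borel R d) (w k))
  (g : nat -> 'I_m -> T -> 'rV[R]_d)
  (gE : forall k i t, g k i t = G (w k t) (zeta k i t))
  (g_meas : forall k i, measurable_wrt measurable (borel R d) (g k i))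
  (g_law : forall k i j, same_cond_law P (past_samples zeta k) (g k i) (g k j))
  (* Byzantine nodes *)
  (q : nat) (byz : nat -> T -> {set 'I_m})
  (byz_card : forall k t, #|byz k t| = q)
  (Bz : nat -> 'I_m -> T -> 'rV[R]_d)
  (gt : nat -> 'I_m -> T -> 'rV[R]_d)
  (gtE : forall k i t,
    gt k i t = if i \in byz k t then Bz k i t else g k i t)
  (* algorithm *)
  (w0 : 'rV[R]_d) (alpha : nat -> R) (Agg : ('I_m -> 'rV[R]_d) -> 'rV[R]_d)
  (A : nat -> T -> 'rV[R]_d)
  (AE : forall k t, A k t = Agg (fun i => gt k i t))
  (w_init : forall t, w 0%N t = w0)
  (w_step : forall k t, w k.+1 t = w k t - alpha k *: A k t)
  (* versions of E_k[G(w_k)], E_k[|G(w_k)|^r], E_k[A_k], E_k[|A_k|^r] *)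
  (EG : nat -> T -> 'rV[R]_d)
  (EGP : forall k i, is_condexp_vec P (past_samples zeta k) (g k i) (EG k))
  (MG : nat -> nat -> T -> \bar R)
  (MGP : forall k r i, is_condexp_nneg P (past_samples zeta k)
    (fun t => (enorm (g k i t) ^+ r)%:E) (MG k r))
  (EA : nat -> T -> 'rV[R]_d)
  (EAP : forall k, is_condexp_vec P (past_samples zeta k) (A k) (EA k))
  (MA : nat -> nat -> T -> \bar R)
  (MAP : forall k r, is_condexp_nneg P (past_samples zeta k)
    (fun t => (enorm (A k t) ^+ r)%:E) (MA k r))
  (* smoothness *)
  (L Flow : R)
  (Fi_smooth : forall i, L_smooth L (Fi i))
  (Fi_low : forall i v, Flow <= Fi i v)
  (* expected smoothness *)
  (EG_grad : forall k, {ae P, forall t, EG k t = grad F (w k t)})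
  (cA cB cC : R) (cA_ge0 : 0 <= cA) (cB_ge0 : 0 <= cB) (cC_ge0 : 0 <= cC)
  (MG_bound : forall k, {ae P, forall t, (MG k 2%N t <=
    (2 * cA * (F (w k t) - Flow) + cB * enorm (grad F (w k t)) ^+ 2 + cC)%:E)%E})
  (* Byzantine resilience with angle theta *)
  (theta : R) (theta_ge0 : 0 <= theta) (theta_lt : theta < pi / 2)
  (EA_angle : forall k, {ae P, forall t,
    (1 - sin theta) * enorm (grad F (w k t)) ^+ 2
      <= dotp (EA k t) (grad F (w k t))})
  (MA_comb : forall r, (2 <= r <= 4)%N ->
    exists2 c : seq (R * seq nat),
      all (fun p => sumn p.2 == r) c &
      forall k, {ae P, forall t, (MA k r t <= moment_comb c (MG k ^~ t))%E})
  (* the constant E, and B' = B E *)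
  (cE : R)
  (MA_E : forall k, {ae P, forall t, (MA k 2%N t <= cE%:E * MG k 2%N t)%E})
  (cB' : R) (cB'E : cB' = cB * cE) (LB'_gt0 : 0 < L * cB')
  (* learning rates *)
  (alpha_gt0 : forall k, 0 < alpha k)
  (alpha_noninc : forall k, alpha k.+1 <= alpha k)
  (alpha0_le : alpha 0%N <= (1 - sin theta) / (L * cB'))
  (alpha_sq : (\sum_(0 <= k <oo) (alpha k ^+ 2)%:E < +oo)%E)
  (alpha_lim : (k%:R * alpha k.-1)^-1 @[k --> \oo] --> (0 : R)) :
  (\big[Order.min/+oo]_(0 <= k < K)
    'E_P[fun t => enorm (grad F (w k t))])%E @[K --> \oo] --> 0%E.
Proof.
have E0 k : (0 <= 'E_P[fun t => enorm (grad F (w k t))])%E.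
  by apply: expectation_ge0 => t; exact: enorm_ge0.
have min_ge0 K : (0 <= \big[Order.min/+oo]_(0 <= k < K)
    'E_P[fun t => enorm (grad F (w k t))])%E.
  exact: le_bigmin.
have min_le K k : (k < K)%N -> (\big[Order.min/+oo]_(0 <= k < K)
    'E_P[fun t => enorm (grad F (w k t))] <=
    'E_P[fun t => enorm (grad F (w k t))])%E.
  by move=> kK; rewrite big_mkord (bigmin_le _ (Ordinal kK)).
(* For [d = 0] the hypotheses do not force [0 < L]. *)
have [d0|d_gt0] := posnP d.
  apply: (@squeeze_cvge _ _ _ _ (cst 0%E) _ (cst 0%E)); [|exact: cvg_cst..].
  near=> K; rewrite min_ge0 /=; apply: (le_trans (min_le K 0%N _)).
    by near: K; exact: nbhs_infty_gt.
  rewrite unlock (eq_integral (cst 0%E)) ?integral0 // => t _.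
  rewrite /enorm /dotp big1 ?sqrtr0 // => j _.
  by exfalso; move: (ltn_ord j); rewrite {2}d0.
have i0 : 'I_m := Ordinal m_gt0.
have L_ge0 : 0 <= L := L_smooth_ge0 d_gt0 (Fi_smooth i0).
have L_gt0 : 0 < L.
  by rewrite lt_neqAle L_ge0 andbT; apply: contraTneq LB'_gt0 => <-; rewrite mul0r ltxx.
(* The sign of [cE] is extracted from [0 < L * cB']: once [L] and [cB] are positive, so is [cE]. *)
have cBE_gt0 : 0 < cB * cE by rewrite -cB'E -(pmulr_rgt0 _ L_gt0).
have cB_gt0 : 0 < cB.
  by rewrite lt_neqAle cB_ge0 andbT; apply: contraTneq cBE_gt0 => <-; rewrite mul0r ltxx.
have cE_gt0 : 0 < cE by rewrite -(pmulr_rgt0 _ cB_gt0).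
have kappa_gt0 : 0 < 1 - sin theta by rewrite subr_gt0 sin_lt1.
set kappa := 1 - sin theta in kappa_gt0 alpha0_le EA_angle.
have mR_gt0 : 0 < m%:R :> R by rewrite ltr0n.
have gradE v : grad F v = m%:R^-1 *: \sum_(i < m) grad (Fi i) v.
  by apply: grad_avg => // i; have [] := Fi_smooth i.
have cF : continuous F.
  rewrite (funext FE); apply: continuous_avg => i v.
  by have [/(_ v)/differentiable_continuous] := Fi_smooth i.
have cgrad j : continuous (fun v => grad F v 0 j).
  have -> : (fun v => grad F v 0 j) =
      fun v => m%:R^-1 * \sum_(i < m) grad (Fi i) v 0 j.
    by apply/funext => v; rewrite gradE mxE summxE.
  apply: continuous_avg => i v; have [_ /(_ v) cgi _] := Fi_smooth i.
  exact: (continuous_comp cgi (@coord_continuous _ _ _ 0 j _)).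
(* Multiplied by [m], this is the sum of the quadratic bounds of the nodes. *)
have quad v u : F (v + u) <= F v + dotp (grad F v) u + L / 2 * dotp u u.
  rewrite !FE gradE dotpZl dotp_suml -(ler_pM2l mR_gt0) 2!mulrDr !mulrA.
  rewrite divff ?gt_eqF // !mul1r.
  have -> : m%:R * L / 2 * dotp u u = \sum_(i < m) (L / 2 * dotp u u).
    by rewrite sumr_const card_ord -[RHS]mulr_natl !mulrA.
  rewrite -!big_split /=; apply: ler_sum => i _; rewrite -enorm_sq.
  exact: L_smooth_quadratic_bound (Fi_smooth i).
have low v : Flow <= F v.
  rewrite FE mulrC ler_pdivlMr // mulr_natr -[X in _ *+ X]card_ord -sumr_const.
  exact: ler_sum.
have al_le k : alpha k <= alpha 0%N.
  by elim: k => // k; apply: le_trans.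
have SM k : past_samples zeta k `<=` measurable.
  exact: past_samples_measurable.
have mFw k : measurable_fun setT (fun t => F (w k t)).
  exact: measurable_wrt_measurable_fun (SM k) (measurable_wrt_continuous cF (w_meas k)).
pose a k := \int[P]_t dotp (grad F (w k t)) (grad F (w k t)).
pose D k := \int[P]_t (F (w k t) - Flow).
have step k : P.-integrable setT (EFin \o (fun t => F (w k t) - Flow)) ->
  [/\ P.-integrable setT (EFin \o (fun t => F (w k.+1 t) - Flow)),
      P.-integrable setT
        (EFin \o (fun t => dotp (grad F (w k t)) (grad F (w k t)))) &
      D k.+1 + alpha k * (kappa / 2 * a k) <=
      (1 + L * cE * cA * alpha k ^+ 2) * D k + L * cE * cC / 2 * alpha k ^+ 2].
  move=> iF; apply: (expected_descent (SM k) (w_meas k) (mFw k.+1) (w_step k)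
    (EAP k) (MAP k 2%N) cF cgrad quad low L_gt0 (alpha_gt0 k) (ltW kappa_gt0)
    cA_ge0 cB_ge0 cC_ge0 (ltW cE_gt0) _ (EA_angle k) _ iF).
  (* Monotonicity passes the bound on the first learning rate to all later ones. *)
  - by rewrite -cB'E -ler_pdivlMr // (le_trans (al_le k)).
  - apply: filterS2 (MA_E k) (MG_bound k) => t MA_t MG_t.
    by apply: le_trans MA_t _; rewrite EFinM lee_pmul2l // lte_fin.
(* The gap is constant at the deterministic start [w0], and each descent step propagates its
   integrability. *)
have iF k : P.-integrable setT (EFin \o (fun t => F (w k t) - Flow)).
  elim: k => [|k /step[]//]; rewrite (_ : _ \o _ = EFin \o cst (F w0 - Flow)).
    exact: Rintegrable_cst.
  by apply/funext => t /=; rewrite w_init.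
have a_ge0 k : 0 <= a k by apply: Rintegral_ge0 => t _; exact: dotp_ge0.
pose S := fine (\sum_(0 <= k <oo) (alpha k ^+ 2)%:E)%E.
have alS K : \sum_(0 <= k < K) alpha k ^+ 2 <= S.
  have al2_ge0 k : (0 <= k)%N -> xpredT k -> (0 <= (alpha k ^+ 2)%:E)%E.
    by rewrite lee_fin sqr_ge0.
  rewrite -lee_fin fineK; last first.
    by rewrite ge0_fin_numE //; exact: nneseries_ge0.
  by rewrite -sumEFin; exact: nneseries_lim_ge.
have [C C_ge0 sum_le] : exists2 C, 0 <= C &
    forall K, \sum_(0 <= k < K) alpha k * (kappa / 2 * a k) <= C.
  apply: (@perturbed_descent_summable _ D _ alpha (L * cE * cA)
    (L * cE * cC / 2) S) => //.
  - by rewrite !mulr_ge0 // ltW.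
  - by rewrite !mulr_ge0 // ltW.
  - by move=> k; apply: Rintegral_ge0 => t _; rewrite subr_ge0.
  - by move=> k; rewrite !mulr_ge0 // ltW.
  - by move=> k; have [] := step k (iF k).
pose s K : R := (K%:R * alpha K.-1)^-1.
have expect_le k (r : R) : 0 < r ->
    ('E_P[fun t => enorm (grad F (w k t))] <= ((r + a k / r) / 2)%:E)%E.
  move=> r0; have [_ igg _] := step k (iF k).
  have -> : (r + a k / r) / 2 = \int[P]_t (2^-1 *
      (r + r^-1 * dotp (grad F (w k t)) (grad F (w k t)))).
    have PT : fine (P setT) = 1 by rewrite probability_setT.
    rewrite RintegralZl //; last first.
      by apply: Rintegrable_add; [exact: Rintegrable_cst|exact: Rintegrable_scale].
    rewrite RintegralD //; [|exact: Rintegrable_cst|exact: Rintegrable_scale].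
    by rewrite RintegralZl // Rintegral_cst // [fine _]PT -/(a k); field; rewrite gt_eqF.
  rewrite unlock /Rintegral fineK; last first.
    apply: integrable_fin_num => //; apply: Rintegrable_scale.
    by apply: Rintegrable_add; [exact: Rintegrable_cst|exact: Rintegrable_scale].
  have cenorm : continuous (fun v => enorm (grad F v)).
    move=> v; apply: (@continuous_comp _ _ _ (fun v => dotp (grad F v) (grad F v))).
      exact: continuous_dotp.
    exact: sqrt_continuous.
  have menorm : measurable_fun setT (fun t => enorm (grad F (w k t))).
    exact: measurable_wrt_measurable_fun (SM k)
      (measurable_wrt_continuous cenorm (w_meas k)).
  apply: ge0_le_integral => //.
  - by move=> t _; rewrite lee_fin enorm_ge0.
  - exact/measurable_EFinP.
  - apply: (measurable_int P); apply: Rintegrable_scale.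
    by apply: Rintegrable_add; [exact: Rintegrable_cst|exact: Rintegrable_scale].
  - move=> t _; rewrite lee_fin -enorm_sq; set e := enorm _.
    (* After clearing denominators the claim is $(e-r)^2\ge 0$. *)
    rewrite ler_pdivlMl // -(ler_pM2l r0) mulrDr mulVKf ?gt_eqF //.
    by have := sqr_ge0 (e - r); nra.
have s_gt0 K : (0 < K)%N -> 0 < s K.
  by move=> K0; rewrite invr_gt0 mulr_gt0 // ltr0n.
(* For the selected [k], [a k] is at most $(2C/\kappa)s_K$. Choosing [r] as the square root of $s_K$
   balances the two terms of [expect_le] and makes the bound [c] times that root. *)
pose c := (1 + 2 / kappa * C) / 2.
apply: (@squeeze_cvge _ _ _ _ (cst 0%E) _
  (fun K => (Num.sqrt (s K) * c)%:E)); [|exact: cvg_cst|].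
  near=> K; have K0 : (0 < K)%N by near: K; exact: nbhs_infty_gt.
  rewrite min_ge0 /=.
  have [k kK xk] := exists_le_of_weighted_sum_le alpha_gt0 alpha_noninc
    (fun k => mulr_ge0 (ltW (divr_gt0 kappa_gt0 (ltr0n _ 2))) (a_ge0 k)) K0 (sum_le K).
  apply: le_trans (min_le K k kK) _.
  have r0 : 0 < Num.sqrt (s K) by rewrite sqrtr_gt0 s_gt0.
  apply: le_trans (expect_le k _ r0) _; rewrite lee_fin /c mulrA.
  rewrite ler_wpM2r // mulrDr mulr1 lerD2l ler_pdivrMr //.
  rewrite mulrAC -expr2 sqr_sqrtr; last exact/ltW/s_gt0.
  move: xk; rewrite -/(s K) -ler_pdivlMl ?divr_gt0 // => /le_trans -> //.
  by rewrite invf_div; lra.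
rewrite -[X in _ --> X]/(0%:E) -[X in X%:E](mul0r c).
apply: cvg_EFin; first exact: nearW.
apply: cvgM; last exact: cvg_cst.
rewrite -[X in _ --> X](@sqrtr0 R).
exact: (cvg_comp _ _ alpha_lim (@sqrt_continuous _ _)).
Unshelve. all: by end_near.
Qed.
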